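(* Let $v\in(0,1)$, let $f:[0,1]\to[0,1]$ be the tent map, $f(x)=2x$ for $0\le x\le 1/2$ and $f(x)=2-2x$ for $1/2\le x\le 1$, and let $f_v(x)=\frac{x}{v}$ for $0\le x\le v$, $f_v(x)=\frac{1-x}{1-v}$ for $v\le x\le 1$. Let $h:[0,1]\to[0,1]$ be the conjugacy of $f$ and $f_v$, i.e. the homeomorphism with $h\circ f=f_v\circ h$. Let $x\in[0,1]$ have binary expansion $0.x_1x_2\ldots$. Then the derivative $h'(x)$ exists if and only if the limit $$P(x)=\prod_{k=2}^{\infty}\bigl(2\,\alpha_v(x_k,x_{k-1})\bigr)=\lim_{n\to\infty}\prod_{k=2}^{n}\bigl(2\,\alpha_v(x_k,x_{k-1})\bigr)$$ exists. Moreover, in this case $h'(x)=P(x)$.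
   Context: For $a,b\in\{0,1\}$, $\alpha_v(a,b)=v$ if $a=b$ and $\alpha_v(a,b)=1-v$ if $a\ne b$. The conjugacy $h$ exists, is unique and increasing. Convention: a derivative is a limit of difference quotients which is allowed to be infinite (value $+\infty$); at the endpoints $0,1$ the one-sided derivative is meant. The limit $P(x)$ is likewise allowed to be $0$ or $+\infty$. The binary expansion of a dyadic rational $x<1$ is the one ending in zeros, and the expansion of $x=1$ is $0.111\ldots$. *)

(* Defs.v *)
From HB Require Import structures.
From mathcomp Require Import all_boot all_order all_algebra.
From mathcomp Require Import all_classical all_reals all_analysis.
Set Implicit Arguments.
Unset Strict Implicit.
Unset Printing Implicit Defensive.
Import Order.TTheory GRing.Theory Num.Theory.
Import numFieldNormedType.Exports.
Local Open Scope classical_set_scope.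
Local Open Scope ring_scope.

(* Maps of [0, 1] are represented by functions R -> R whose values outside
   [0, 1] are irrelevant: the definitions below only inspect them on [0, 1]. *)

Definition tent (R : realType) (x : R) : R :=
  if x <= 1 / 2 then 2 * x else 2 - 2 * x.

Definition skew_tent (R : realType) (v x : R) : R :=
  if x <= v then x / v else (1 - x) / (1 - v).

Definition homeomorphism01 (R : realType) (h : R -> R) : Prop :=
  [/\ set_bij `[0, 1] `[0, 1] h,
      {within `[0, 1], continuous h} &
      exists g : R -> R,
        [/\ set_fun `[0, 1] `[0, 1] g,
            {within `[0, 1], continuous g},
            (forall x : R, x \in `[0, 1] -> g (h x) = x) &
            (forall y : R, y \in `[0, 1] -> h (g y) = y)]].

Definition conjugacy01 (R : realType) (f g h : R -> R) : Prop :=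
  homeomorphism01 h /\ forall x : R, x \in `[0, 1] -> h (f x) = g (h x).

Definition alpha (R : realType) (v : R) (a b : bool) : R :=
  if a == b then v else 1 - v.

Definition dyadic (R : realType) (x : R) : Prop :=
  exists m n : nat, x = m%:R / 2 ^+ n.

(* The digits are d 1, d 2, ...; the value d 0 plays no role.  The second
   clause selects, for a dyadic x < 1, the expansion ending in zeros.  For
   x = 1 the first clause alone forces 0.111... *)
Definition binary_expansion (R : realType) (x : R) (d : nat -> bool) : Prop :=
  (\sum_(1 <= k < n.+1) ((d k)%:R / 2 ^+ k : R)) @[n --> \oo] --> x /\
  (dyadic x -> x < 1 ->
     exists N : nat, forall k : nat, (N <= k)%N -> d k = false).

(* y tends to x within [0, 1] with y <> x, so at 0 and 1 this is the one-sided
   derivative.  The value +oo is allowed. *)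
Definition is_deriv01 (R : realType) (h : R -> R) (x : R) (l : \bar R) : Prop :=
  l <> -oo%E /\
  ((h y - h x) / (y - x))%:E @[y --> within `[0, 1] x^'] --> l.

(* Limits are taken in the extended reals, so 0 and +oo are allowed. *)
Definition is_digit_product (R : realType) (v : R) (d : nat -> bool)
    (p : \bar R) : Prop :=
  (\prod_(2 <= k < n.+1) (2 * alpha v (d k) (d k.-1)))%:E @[n --> \oo] --> p.

(* Main.v *)
Require Import Defs.
From mathcomp Require Import all_boot all_order all_algebra.
From mathcomp Require Import all_classical all_reals all_analysis.
From mathcomp Require Import ring lra zify.
Set Implicit Arguments.
Unset Strict Implicit.
Unset Printing Implicit Defensive.
Import Order.TTheory GRing.Theory Num.Theory.
Import numFieldNormedType.Exports.
Local Open Scope classical_set_scope.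
Local Open Scope ring_scope.

(** The conjugacy turns the two inverse branches [x / 2] and [1 - x / 2] of the
    tent map into the affine maps of ratios [v] and [- (1 - v)], so [h] is
    monotone and self-similar ([conjugacy_self_similar]).  Hence [h] stretches
    every dyadic interval of rank [n] by a product of [n] factors.  Reading the
    self-similarity from the last digit instead of the first
    ([gap_append]), halving a dyadic interval whose last digit is [a] multiplies
    the increment of [h] by [alpha v b a], where [b] is the digit that is
    appended.  The mean slope of [h] on the rank [n] dyadic interval around [x]
    is therefore [c * P_n], where [P_n] is the partial digit product and
    [c = 2 * alpha v x_1 0] comes from the first digit ([slope_prod]).

    The constant [c] is harmless.  Unless [v = 1/2], every factor of [P_n]
    differs from 1 by the fixed amount [`|2 * v - 1|], so [P_n] can only tend to
    0 or to [+oo] ([digit_product_dichotomy]), two values that multiplication by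
    [c > 0] preserves.  If [v = 1/2] then [h] is the identity
    ([self_similar_half]) and all factors are 1.

    It remains to compare slopes with difference quotients at [x].

    If [h'(x)] exists, the slopes converge to it: the interval of rank [n]
    contains [x], so its slope is a mean of difference quotients at [x]
    ([deriv01_cvg_slope]).

    Conversely, [gap_neighbour] shows that the increments of [h] over two
    adjacent dyadic intervals of the same rank are comparable, up to the factor
    [v * (1 - v)]: such intervals have digits [w 0 1 ... 1] and [w 1 0 ... 0],
    and the two products differ only at the first digit after [w].  When
    [`|y - x|] is about [2 ^- n], the segment from [x] to [y] is covered by two
    adjacent intervals of rank [n] and contains one of rank [n + 2] adjacent to
    the interval of [x].  So the difference quotient lies between constant
    multiples of the slopes at ranks [n + 2] and [n].  That is not enough to
    transport a finite nonzero limit, but it does transport the limits 0 and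
    [+oo], the only ones that occur ([cvg_slope_deriv01]). *)

(** * Limits in the extended reals and dyadic neighbourhoods *)

(** Treats finite and infinite limits at once: the lower and the upper half of
    a convergence are proved by separate estimates below, and at an infinite
    limit one of the two halves is vacuous. *)
Lemma cvg_EFin_bounds (R : realType) (T : Type) (F : set_system T)
    {FF : Filter F} (f : T -> R) (l : \bar R) :
  ((f t)%:E @[t --> F] --> l) <->
  (forall M : R, (M%:E < l)%E -> \forall t \near F, M <= f t) /\
  (forall M : R, (l < M%:E)%E -> \forall t \near F, f t <= M).
Proof.
case: l => [r| |].
- split.
    move=> /fine_cvgP[_ /cvgrPdist_le fr]; split=> M; rewrite lte_fin => rM.
      have := fr (r - M); rewrite subr_gt0 => /(_ rM).
      by apply: filterS => t /=; rewrite ler_norml => /andP[_]; lra.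
    have := fr (M - r); rewrite subr_gt0 => /(_ rM).
    by apply: filterS => t /=; rewrite ler_norml => /andP[+ _]; lra.
  case=> lo up; apply/fine_cvgP; split; first by apply: nearW.
  apply/cvgrPdist_le => e e0.
  have := lo (r - e); rewrite lte_fin ltrBlDr ltrDl => /(_ e0) loe.
  have := up (r + e); rewrite lte_fin ltrDl => /(_ e0) upe.
  by apply: filterS2 loe upe => t /=; rewrite ler_norml; lra.
- split.
    move=> /cvgeyPge fy; split=> M; last by rewrite ltNge leey.
    by move=> _; apply: filterS (fy M) => t; rewrite lee_fin.
  case=> lo _; apply/cvgeyPge => M; apply: filterS (lo M _) => [t|].
    by rewrite lee_fin.
  exact: ltry.
- split.
    move=> /cvgeNyPle fy; split=> M; first by rewrite ltNge leNye.
    by move=> _; apply: filterS (fy M) => t; rewrite lee_fin.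
  case=> _ up; apply/cvgeNyPle => M; apply: filterS (up M _) => [t|].
    by rewrite lee_fin.
  exact: ltNyr.
Qed.

Lemma exists_exp2N_lt (R : realType) (e : R) : 0 < e ->
  exists n : nat, 2 ^- n < e.
Proof.
move=> e0; exists (Num.bound e^-1).
rewrite invf_plt ?posrE ?exprn_gt0//.
exact: upper_nthrootP.
Qed.

Lemma exp2N_homo (R : realType) (m n : nat) : (m <= n)%N -> 2 ^- n <= 2 ^- m :> R.
Proof. by move=> mn; rewrite lef_pV2 ?posrE ?exprn_gt0// ler_weXn2l// ler1n. Qed.

(** Imposing [N <= n] makes the boundary case [e = 2 ^- N], which two scales
    satisfy, resolve to a scale that is at least [N]. *)
Lemma exists_exp2N_scale (R : realType) (e : R) (N : nat) : 0 < e <= 2 ^- N ->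
  exists2 n : nat, (N <= n)%N & 2 ^- n.+1 <= e <= 2 ^- n.
Proof.
move=> /andP[e0 eN].
have ex : exists n, (2 ^- (N + n).+1 : R) <= e.
  have [n /ltW en] := exists_exp2N_lt e0; exists n.
  by apply: le_trans en; rewrite exp2N_homo// ltnW// ltnS leq_addl.
case: (ex_minnP ex) => n ne nmin; exists (N + n)%N; first exact: leq_addr.
rewrite ne /=; case: n nmin {ne} => [|n] nmin; first by rewrite addn0.
rewrite addnS ltW// ltNge; apply/negP => /nmin.
by rewrite ltnn.
Qed.

Lemma near_punctured01 (R : realType) (x : R) (P : R -> Prop) :
  (\forall y \near within `[0, 1] x^', P y) <->
  exists n : nat, forall y, y \in `[0, 1] -> y != x -> `|y - x| <= 2 ^- n -> P y.
Proof.
split.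
  move=> [e /= e0 He]; have [n ne] := exists_exp2N_lt e0.
  exists n => y y01 yx yn; apply: (He y) => //=.
  by rewrite distrC (le_lt_trans yn).
case=> n H; exists (2 ^- n : R) => /=; first by rewrite invr_gt0 exprn_gt0.
by move=> y /= yn yx y01; apply: H => //; rewrite distrC ltW.
Qed.

(** * Self-similarity of the conjugacy *)

(** The functional equation [h \o f = f_v \o h], solved for [h] along the two
    inverse branches of the tent map. *)
Definition skew_self_similar (R : realType) (v : R) (h : R -> R) : Prop :=
  [/\ {in `[0, 1] &, {homo h : x y / x <= y}}, h 0 = 0, h 1 = 1,
      forall x, x \in `[0, 1] -> h (x / 2) = v * h x &
      forall x, x \in `[0, 1] -> h (1 - x / 2) = 1 - (1 - v) * h x].

(** A continuous injection of the segment is strictly monotone.  It cannot be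
    decreasing: then [h 0 = 1], whereas 0 is fixed by [f] and 1 is not fixed by
    [f_v].  Finally [h (1 / 2) = v], because [v] is the only point that [f_v]
    sends to [1 = h (f (1 / 2))]; this decides which branch of [f_v] applies. *)
Lemma conjugacy_self_similar (R : realType) (v : R) (h : R -> R) :
  0 < v -> v < 1 -> conjugacy01 (@tent R) (skew_tent v) h ->
  skew_self_similar v h.
Proof.
move=> v0 v1 [[[hfun hI hsurj] hcont _] hconj].
have h01 x : x \in `[0, 1] -> 0 <= h x <= 1.
  by move=> x01; have /= := hfun x x01; rewrite in_itv.
have hinj : {in `[0, 1] &, injective h}.
  by move=> x y x01 y01; apply: hI; rewrite inE.
have I0 : (0 : R) \in `[0, 1] by rewrite in_itv /= lexx ler01.
have I1 : (1 : R) \in `[0, 1] by rewrite in_itv /= lexx ler01.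
have surj y : y \in `[0, 1] -> exists2 x, x \in `[0, 1] & h x = y.
  by move=> y01; have [x /= x01 <-] := hsurj y y01; exists x.
have [x0 x0I hx0] := surj 0 I0.
have [x1 x1I hx1] := surj 1 I1.
have f0 : tent (0 : R) = 0 by rewrite /tent mulr0; case: ifP => //; lra.
have h0N1 : h 0 != 1.
  apply/eqP => h0; have := hconj 0 I0; rewrite f0 h0 /skew_tent.
  by rewrite leNgt v1 /= subrr mul0r => /eqP; rewrite oner_eq0.
have hmono : {in `[0, 1] &, {mono h : x y / x <= y}}.
  apply: segment_continuous_inj_le => //.
  rewrite leNgt; apply/negP => h10.
  have dec : {in `[0, 1] &, {mono h : x y /~ x <= y}}.
    exact: segment_continuous_inj_ge (ltW h10) hcont hinj.
  have := dec x1 0 x1I I0; rewrite hx1.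
  have /andP[x1ge _] : 0 <= x1 <= 1 by move: x1I; rewrite in_itv.
  have /andP[_ h0le] := h01 0 I0.
  by rewrite x1ge => h0ge; move: h0N1; rewrite eq_le h0le h0ge.
have hhomo : {in `[0, 1] &, {homo h : x y / x <= y}}.
  by move=> x y xI yI xy; rewrite hmono.
have h0 : h 0 = 0.
  apply/eqP; rewrite eq_le; have /andP[-> _] := h01 0 I0; rewrite andbT -[leRHS]hx0.
  by apply: hhomo => //; move: x0I; rewrite in_itv => /andP[].
have h1 : h 1 = 1.
  apply/eqP; rewrite eq_le; have /andP[_ ->] := h01 1 I1; rewrite /= -[leLHS]hx1.
  by apply: hhomo => //; move: x1I; rewrite in_itv => /andP[].
have vN0 : v != 0 by rewrite gt_eqF.
have wN0 : 1 - v != 0 by rewrite subr_eq0 gt_eqF.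
have IH : (1 / 2 : R) \in `[0, 1] by rewrite in_itv /=; lra.
have hhalf : h (1 / 2) = v.
  have := hconj _ IH; rewrite /tent lexx.
  have -> : 2 * (1 / 2) = 1 :> R by field.
  rewrite h1 /skew_tent; case: ifP => _ e.
    by rewrite -[LHS](divfK vN0) -e mul1r.
  have : (1 - h (1 / 2)) = 1 - v by rewrite -[LHS](divfK wN0) -e mul1r.
  by lra.
split=> // x xI; move: (xI); rewrite in_itv /= => /andP[xge xle].
  have xh : x / 2 \in `[0, 1] by rewrite in_itv /=; lra.
  have := hconj _ xh; rewrite /tent ifT; last by lra.
  rewrite /skew_tent -{1}hhalf hmono// ifT; last by lra.
  by rewrite (mulrC 2) divfK// => ->; rewrite mulrCA divff ?mulr1.
have xh : 1 - x / 2 \in `[0, 1] by rewrite in_itv /=; lra.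
have := hconj _ xh; rewrite /tent /skew_tent -{1}hhalf hmono//.
have [xhalf|_] := leP (1 - x / 2) (1 / 2).
  have -> : x = 1 by lra.
  move=> _; rewrite h1.
  have -> : 1 - 1 / 2 = 1 / 2 :> R by lra.
  by rewrite hhalf; ring.
have -> : 2 - 2 * (1 - x / 2) = x by field.
by move=> ->; rewrite mulrCA divff// mulr1 subKr.
Qed.

(** * Increments over dyadic intervals *)

Definition gap (R : realType) (h : R -> R) (n k : nat) : R :=
  h (k.+1%:R / 2 ^+ n) - h (k%:R / 2 ^+ n).

Lemma dyadic_in01 (R : realType) (n k : nat) : (k <= 2 ^ n)%N ->
  (k%:R / 2 ^+ n : R) \in `[0, 1].
Proof.
move=> kn; rewrite in_itv /= divr_ge0 ?exprn_ge0//=.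
by rewrite ler_pdivrMr ?exprn_gt0// mul1r -natrX ler_nat.
Qed.

Lemma dyadic_succ (R : realType) (n k : nat) :
  k.+1%:R / 2 ^+ n = k%:R / 2 ^+ n + 2 ^- n :> R.
Proof. by rewrite -natr1 mulrDl mul1r. Qed.

Lemma gap_ge0 (R : realType) (v : R) (h : R -> R) (n k : nat) :
  skew_self_similar v h -> (k < 2 ^ n)%N -> 0 <= gap h n k.
Proof.
move=> [hh _ _ _ _] kn; rewrite subr_ge0 hh ?dyadic_in01 ?(ltnW kn)//.
by rewrite ler_pM2r ?invr_gt0 ?exprn_gt0// ler_nat.
Qed.

Lemma gap_left (R : realType) (v : R) (h : R -> R) (n k : nat) :
  skew_self_similar v h -> (k < 2 ^ n)%N ->
  gap h n.+1 k = v * gap h n k.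
Proof.
move=> [_ _ _ hl _] kn; rewrite /gap mulrBr -!hl ?dyadic_in01 ?(ltnW kn)//.
by rewrite exprSr !invfM !mulrA.
Qed.

Lemma gap_right (R : realType) (v : R) (h : R -> R) (n k : nat) :
  skew_self_similar v h -> (k < 2 ^ n)%N ->
  gap h n.+1 (2 ^ n.+1 - k.+1) = (1 - v) * gap h n k.
Proof.
move=> [_ _ _ _ hr] kn.
have dy j : (j <= 2 ^ n)%N ->
    (2 ^ n.+1 - j)%:R / 2 ^+ n.+1 = 1 - (j%:R / 2 ^+ n) / 2 :> R.
  move=> jn; rewrite natrB; last by rewrite expnS; lia.
  rewrite natrX exprSr; field.
  by rewrite expf_neq0.
rewrite /gap dy// -subSn; last by rewrite expnS; lia.
by rewrite subSS dy ?(ltnW kn)// !hr ?dyadic_in01 ?(ltnW kn)//; ring.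
Qed.

(** The equations [gap_left] and [gap_right] act on the leading digit; this one
    acts on the trailing digit, whose predecessor is the parity of [k].  The
    induction is on the leading digit: on the right half the tent map complements
    every digit, and [alpha] is unchanged when both of its digits are
    complemented.  At rank 0 the missing predecessor counts as the digit 0. *)
Lemma gap_append (R : realType) (v : R) (h : R -> R) (n k : nat) (b : bool) :
  skew_self_similar v h -> (k < 2 ^ n)%N ->
  gap h n.+1 (b + k.*2) = alpha v b (odd k) * gap h n k.
Proof.
move=> hS; elim: n k b => [|n IHn] k b kn.
  case: k kn => // _; case: b; rewrite /alpha /=.
    by rewrite -(gap_right (n := 0) (k := 0) hS).
  by rewrite -(gap_left (n := 0) (k := 0) hS).
have [kl|kl] := ltnP k (2 ^ n).
  rewrite (gap_left hS)//; last by rewrite expnS; case: b; lia.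
  by rewrite IHn// (gap_left hS)// mulrCA.
(* [j] is the reflection of [k]: all its digits are complemented. *)
have [j jn kE] : exists2 j, (j < 2 ^ n)%N & k = (2 ^ n.+1 - j.+1)%N.
  by exists (2 ^ n.+1 - k.+1)%N; move: kn; rewrite expnS; lia.
have -> : (b + k.*2 = 2 ^ n.+2 - (~~ b + j.*2).+1)%N.
  by move: jn; rewrite kE !expnS; case: b; lia.
rewrite (gap_right hS)//; last by move: jn; rewrite expnS; case: b; lia.
rewrite IHn// {2}kE (gap_right hS)// mulrCA; congr (_ * _).
have -> : odd k = ~~ odd j.
  by rewrite kE oddB ?expnS ?oddM//; move: jn; lia.
by rewrite /alpha; case: b; case: (odd j).
Qed.

Lemma alpha_bounds (R : realType) (v : R) (a b : bool) : 0 < v -> v < 1 ->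
  v * (1 - v) <= alpha v a b <= 1.
Proof. by move=> v0 v1; rewrite /alpha; case: ifP => _; nra. Qed.

(** If the two intervals are the halves of one interval, they share all factors
    but the last.  Otherwise their parents are adjacent and the appended digits
    are 1 after [odd j] and 0 after its negation, so the new factors agree and
    the ratio is inherited from the parents. *)
Lemma gap_neighbour (R : realType) (v : R) (h : R -> R) (n k : nat) :
  0 < v -> v < 1 -> skew_self_similar v h -> (k.+1 < 2 ^ n)%N ->
  v * (1 - v) * gap h n k <= gap h n k.+1 /\
  v * (1 - v) * gap h n k.+1 <= gap h n k.
Proof.
move=> v0 v1 hS; elim: n k => [|n IHn] k kn; first by move: kn; rewrite expn0.
rewrite -[k]odd_double_half; set j := k./2.
have jn : (j < 2 ^ n)%N by move: kn; rewrite /j expnS; lia.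
case kodd: (odd k); last first.
  rewrite add0n -[j.*2.+1]/(true + j.*2)%N -[j.*2]/(false + j.*2)%N.
  have g0 := gap_ge0 hS jn.
  rewrite !(gap_append _ hS)// !mulrA.
  have /andP[? ?] := alpha_bounds true (odd j) v0 v1.
  have /andP[? ?] := alpha_bounds false (odd j) v0 v1.
  have c0 : 0 <= v * (1 - v) by rewrite mulr_ge0 ?subr_ge0// ltW.
  by split; apply: ler_wpM2r => //; apply: le_trans (ler_piMr c0 _) _.
have jn1 : (j.+1 < 2 ^ n)%N.
  by move: kn; rewrite -[k]odd_double_half kodd -/j expnS; lia.
(* A carry: the successor of [2 * j + 1] is the left half of interval [j + 1]. *)
have -> : (true + j.*2).+1 = (false + j.+1.*2)%N by [].
rewrite !(gap_append _ hS)//=.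
have -> : alpha v false (~~ odd j) = alpha v true (odd j).
  by rewrite /alpha; case: odd.
have [IH1 IH2] := IHn j jn1.
have a0 : 0 <= alpha v true (odd j).
  have /andP[+ _] := alpha_bounds true (odd j) v0 v1.
  by apply: le_trans; rewrite mulr_ge0 ?subr_ge0// ltW.
by rewrite !(mulrCA (v * (1 - v))); split; apply: ler_wpM2l.
Qed.

(** A point at distance at most [2 ^- n] from [x] lies in the dyadic interval of
    [x] or in one of its two neighbours. *)
Lemma oscillation_le (R : realType) (v : R) (h : R -> R) (n k : nat) (x y : R) :
  0 < v -> v < 1 -> skew_self_similar v h -> (k < 2 ^ n)%N ->
  x \in `[0, 1] -> y \in `[0, 1] ->
  k%:R / 2 ^+ n <= x <= k.+1%:R / 2 ^+ n -> `|y - x| <= 2 ^- n ->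
  v * (1 - v) * `|h y - h x| <= 2 * gap h n k.
Proof.
move=> v0 v1 hS kn xI yI /andP[xl xr] yx.
have g0 := gap_ge0 hS kn.
have c0 : 0 <= v * (1 - v) by rewrite mulr_ge0 ?subr_ge0// ltW.
have c1 : v * (1 - v) <= 1 by nra.
have near_bound w : w <= gap h n k -> v * (1 - v) * w <= 2 * gap h n k.
  move=> /(ler_wpM2l c0) /le_trans; apply.
  by apply: ler_wpM2r => //; apply: le_trans c1 _; rewrite ler1n.
have far_bound w g : w <= gap h n k + g -> v * (1 - v) * g <= gap h n k ->
    v * (1 - v) * w <= 2 * gap h n k.
  move=> /(ler_wpM2l c0) /le_trans wg cg; apply: wg.
  by rewrite mulrDr mulr2n mulrDl mul1r lerD// ler_piMl.
have := hS => -[hh _ _ _ _].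
have sE := dyadic_succ R n.
have lI : (k%:R / 2 ^+ n : R) \in `[0, 1] by apply/dyadic_in01/ltnW.
have rI : (k.+1%:R / 2 ^+ n : R) \in `[0, 1] by apply/dyadic_in01.
move: yx; rewrite ler_norml => /andP[yx1 yx2].
have [xy|/ltW xy] := leP x y.
  rewrite ger0_norm ?subr_ge0 ?hh//.
  have hl := hh _ _ lI xI xl.
  have [yr|ry] := leP y (k.+1%:R / 2 ^+ n).
    by apply: near_bound; have := hh _ _ yI rI yr; rewrite /gap; lra.
  have kn1 : (k.+1 < 2 ^ n)%N.
    rewrite -(ltr_nat R) natrX -(ltr_pM2r (x := 2 ^- n)) ?invr_gt0 ?exprn_gt0//.
    rewrite divff ?expf_neq0//; apply: lt_le_trans ry _.
    by move: yI; rewrite in_itv => /andP[].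
  have [_ cg] := gap_neighbour v0 v1 hS kn1.
  have rrI : (k.+2%:R / 2 ^+ n : R) \in `[0, 1] by apply/dyadic_in01.
  have := hh _ _ yI rrI; rewrite sE => /(_ ltac:(lra)).
  by move=> hr; apply: far_bound cg; move: hr; rewrite /gap -sE; lra.
rewrite ler0_norm ?subr_le0 ?hh//.
have hr := hh _ _ xI rI xr.
have [ly|yl] := leP (k%:R / 2 ^+ n) y.
  by apply: near_bound; have := hh _ _ lI yI ly; rewrite /gap; lra.
case: k kn g0 near_bound far_bound sE lI rI xl xr hr yl
  => [|k] kn g0 near_bound far_bound sE lI rI xl xr hr yl.
  by move: yl yI; rewrite mul0r in_itv /= => ?; lra.
have [cg _] := gap_neighbour v0 v1 hS kn.
have llI : (k%:R / 2 ^+ n : R) \in `[0, 1].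
  by apply/dyadic_in01/ltnW/ltnW.
have := hh _ _ llI yI; move: xl; rewrite sE => xl /(_ ltac:(lra)).
by move=> hl; apply: far_bound cg; move: hl; rewrite /gap; lra.
Qed.

(** At distance [2 * 2 ^- n] there is room for a whole neighbour of the dyadic
    interval of [x] between [x] and [y]. *)
Lemma oscillation_ge (R : realType) (v : R) (h : R -> R) (n k : nat) (x y : R) :
  0 < v -> v < 1 -> skew_self_similar v h -> (k < 2 ^ n)%N ->
  x \in `[0, 1] -> y \in `[0, 1] ->
  k%:R / 2 ^+ n <= x <= k.+1%:R / 2 ^+ n -> 2 * 2 ^- n <= `|y - x| ->
  v * (1 - v) * gap h n k <= `|h y - h x|.
Proof.
move=> v0 v1 hS kn xI yI /andP[xl xr] yx.
have := hS => -[hh _ _ _ _].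
have sE := dyadic_succ R n.
have e0 : 0 < 2 ^- n :> R by rewrite invr_gt0 exprn_gt0.
have [xy|/ltW xy] := leP x y.
  move: yx; rewrite !ger0_norm ?subr_ge0 ?hh// => yx.
  have ry : k.+2%:R / 2 ^+ n <= y by rewrite sE; lra.
  have kn1 : (k.+1 < 2 ^ n)%N.
    rewrite -(ler_nat R) natrX -(ler_pM2r (x := 2 ^- n)) ?invr_gt0 ?exprn_gt0//.
    rewrite divff ?expf_neq0//; apply: le_trans ry _.
    by move: yI; rewrite in_itv => /andP[].
  have [+ _] := gap_neighbour v0 v1 hS kn1.
  have rI : (k.+1%:R / 2 ^+ n : R) \in `[0, 1] by apply/dyadic_in01.
  have rrI : (k.+2%:R / 2 ^+ n : R) \in `[0, 1] by apply/dyadic_in01.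
  have := hh _ _ rrI yI ry; have := hh _ _ xI rI xr.
  by rewrite /gap; lra.
move: yx; rewrite !ler0_norm ?subr_le0 ?hh// => yx.
case: k kn xl xr => [|k] kn xl xr.
  by move: xr yI; rewrite sE mul0r in_itv /= => ? /andP[]; lra.
have [_] := gap_neighbour v0 v1 hS kn.
have lI : (k.+1%:R / 2 ^+ n : R) \in `[0, 1] by apply/dyadic_in01/ltnW.
have llI : (k%:R / 2 ^+ n : R) \in `[0, 1].
  by apply/dyadic_in01/ltnW/ltnW.
have := hh _ _ yI llI; move: (xr); rewrite !sE => xr' /(_ ltac:(lra)).
by have := hh _ _ lI xI xl; rewrite /gap; lra.
Qed.

(** * Slopes along the binary expansion *)

(** The integer whose binary digits are [d 1 ... d n], so that [x] lies in the
    dyadic interval of rank [n] with this index. *)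
Fixpoint binary_prefix (d : nat -> bool) (n : nat) : nat :=
  if n is m.+1 then d n + (binary_prefix d m).*2 else 0.

Lemma binary_prefix_lt (d : nat -> bool) (n : nat) :
  (binary_prefix d n < 2 ^ n)%N.
Proof. by elim: n => //= n IHn; rewrite expnS; case: (d _); lia. Qed.

Lemma sum_digits (R : realType) (d : nat -> bool) (n : nat) :
  \sum_(1 <= k < n.+1) ((d k)%:R / 2 ^+ k : R)
    = (binary_prefix d n)%:R / 2 ^+ n.
Proof.
elim: n => [|n IHn]; first by rewrite big_geq// mul0r.
rewrite big_nat_recr//= IHn natrD -muln2 natrM exprS; field.
by rewrite expf_neq0.
Qed.

Lemma binary_prefix_enclosure (R : realType) (x : R) (d : nat -> bool) n :
  binary_expansion x d ->
  (binary_prefix d n)%:R / 2 ^+ n <= x <= (binary_prefix d n).+1%:R / 2 ^+ n.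
Proof.
set a := fun m => (binary_prefix d m)%:R / 2 ^+ m : R.
move=> [dx _]; have ax : a m @[m --> \oo] --> x.
  by under eq_fun do rewrite /a -sum_digits.
have e0 m : 0 < 2 ^- m :> R by rewrite invr_gt0 exprn_gt0.
have aS m : a m.+1 = a m + (d m.+1)%:R * 2 ^- m.+1.
  rewrite /a/= natrD -muln2 natrM exprS; field.
  by rewrite expf_neq0.
have eS m : 2 ^- m = 2 * 2 ^- m.+1 :> R.
  by rewrite exprS invfM mulrA divff ?mul1r.
have lo m j : a m <= a (j + m)%N.
  elim: j => // j IHj; apply: le_trans IHj _; rewrite addSn aS lerDl.
  by rewrite mulr_ge0// ltW.
(* Right endpoints decrease with the rank, as left endpoints increase. *)
have up m j : a (j + m)%N + 2 ^- (j + m) <= a m + 2 ^- m.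
  elim: j => // j IHj; apply: le_trans IHj; rewrite addSn aS.
  have := e0 (j + m).+1; have := eS (j + m)%N.
  by case: (d _) => /=; rewrite ?mul1r ?mul0r; lra.
apply/andP; split.
  apply: (ler_cvg_to (cvg_cst _) ax); exists n => // m /= nm.
  by rewrite -(subnK nm); apply: lo.
rewrite dyadic_succ.
apply: (ler_cvg_to ax (cvg_cst _)); exists n => // m /= nm.
by rewrite -(subnK nm); apply: le_trans _ (up n (m - n)%N); rewrite lerDl ltW.
Qed.

Definition slope (R : realType) (h : R -> R) (d : nat -> bool) (n : nat) : R :=
  2 ^+ n * gap h n (binary_prefix d n).

Lemma slope_ge0 (R : realType) (v : R) (h : R -> R) (d : nat -> bool) n :
  skew_self_similar v h -> 0 <= slope h d n.
Proof. by move=> hS; rewrite mulr_ge0// (gap_ge0 hS)// binary_prefix_lt. Qed.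

(** The product of the statement starts at the pair [(d 2, d 1)]; the factor in
    front comes from the first digit, whose predecessor counts as 0. *)
Lemma slope_prod (R : realType) (v : R) (h : R -> R) (d : nat -> bool) n :
  skew_self_similar v h ->
  slope h d n.+1 = 2 * alpha v (d 1%N) false *
                   \prod_(2 <= k < n.+2) (2 * alpha v (d k) (d k.-1)).
Proof.
move=> hS; elim: n => [|n IHn].
  rewrite big_geq// mulr1 /slope -[binary_prefix d 1]/(d 1%N + 0.*2)%N.
  rewrite (gap_append _ hS)// expr1 -[odd 0]/false /gap mul0r divr1.
  by case: hS => _ -> -> _ _; rewrite subr0 mulr1.
rewrite big_nat_recr// mulrA -IHn /slope.
rewrite -[binary_prefix d n.+2]/(d n.+2 + (binary_prefix d n.+1).*2)%N.
rewrite (gap_append _ hS) ?binary_prefix_lt//.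
have -> : odd (binary_prefix d n.+1) = d n.+1.
  by rewrite /= oddD odd_double addbF; case: (d _).
by rewrite (exprS _ n.+1) -[n.+2.-1]/(n.+1); ring.
Qed.

(** The increment of [h] over [[a, b]] splits at [x] into two increments with
    one end at [x], one of which may be trivial. *)
Lemma secant_le (R : realType) (h : R -> R) (a b x M : R) : a <= x <= b ->
  (forall y, a <= y <= b -> y != x -> (h y - h x) / (y - x) <= M) ->
  h b - h a <= M * (b - a).
Proof.
move=> /andP[ax xb] H.
have hb : h b - h x <= M * (b - x).
  move: xb; rewrite le_eqVlt => /predU1P[<-|xb]; first by rewrite !subrr mulr0.
  have := H b; rewrite (le_trans ax (ltW xb)) lexx => /(_ isT).
  by rewrite ler_pdivrMr ?subr_gt0// gt_eqF// => /(_ isT).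
have ha : h x - h a <= M * (x - a).
  move: ax; rewrite le_eqVlt => /predU1P[<-|ax]; first by rewrite !subrr mulr0.
  have := H a; rewrite lexx (le_trans (ltW ax) xb) => /(_ isT).
  rewrite lt_eqF// => /(_ isT).
  by rewrite -[h a - h x]opprB -[a - x]opprB mulNr invrN mulrN opprK
    ler_pdivrMr ?subr_gt0.
by lra.
Qed.

Lemma secant_ge (R : realType) (h : R -> R) (a b x M : R) : a <= x <= b ->
  (forall y, a <= y <= b -> y != x -> M <= (h y - h x) / (y - x)) ->
  M * (b - a) <= h b - h a.
Proof.
move=> axb H; rewrite -lerN2 -mulNr opprB addrC -[h a]opprK.
apply: (secant_le (h := fun y => - h y) axb) => y ayb yx.
by rewrite -opprD mulNr lerN2 H.
Qed.

Lemma binary_prefix_dist (R : realType) (x y : R) d n :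
  binary_expansion x d ->
  (binary_prefix d n)%:R / 2 ^+ n <= y <= (binary_prefix d n).+1%:R / 2 ^+ n ->
  y \in `[0, 1] /\ `|y - x| <= 2 ^- n.
Proof.
move=> hd; have := binary_prefix_enclosure n hd.
have := dyadic_in01 R (binary_prefix_lt d n).
have := dyadic_in01 R (ltnW (binary_prefix_lt d n)).
rewrite dyadic_succ !in_itv /= ler_norml => /andP[? ?] /andP[? ?].
by move=> /andP[? ?] /andP[? ?]; split; lra.
Qed.

Lemma slope_secant (R : realType) (h : R -> R) d n :
  h ((binary_prefix d n).+1%:R / 2 ^+ n) - h ((binary_prefix d n)%:R / 2 ^+ n)
  = slope h d n * ((binary_prefix d n).+1%:R / 2 ^+ n -
                   (binary_prefix d n)%:R / 2 ^+ n).
Proof.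
rewrite dyadic_succ (addrC _ (2 ^- n)) addrK /slope /gap dyadic_succ mulrAC.
by rewrite divff ?mul1r ?expf_neq0// addrC.
Qed.

Lemma slope_le (R : realType) (h : R -> R) (x : R) d (n : nat) (M : R) :
  binary_expansion x d ->
  (forall y, y \in `[0, 1] -> y != x -> `|y - x| <= 2 ^- n ->
     (h y - h x) / (y - x) <= M) -> slope h d n <= M.
Proof.
move=> hd H; have := @secant_le _ h _ _ x M (binary_prefix_enclosure n hd).
rewrite slope_secant ler_pM2r; last first.
  by rewrite subr_gt0 ltr_pM2r ?invr_gt0 ?exprn_gt0// ltr_nat.
by apply=> y /(binary_prefix_dist hd)[y01 yx] yNx; apply: H.
Qed.

Lemma slope_ge (R : realType) (h : R -> R) (x : R) d (n : nat) (M : R) :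
  binary_expansion x d ->
  (forall y, y \in `[0, 1] -> y != x -> `|y - x| <= 2 ^- n ->
     M <= (h y - h x) / (y - x)) -> M <= slope h d n.
Proof.
move=> hd H; have := @secant_ge _ h _ _ x M (binary_prefix_enclosure n hd).
rewrite slope_secant ler_pM2r; last first.
  by rewrite subr_gt0 ltr_pM2r ?invr_gt0 ?exprn_gt0// ltr_nat.
by apply=> y /(binary_prefix_dist hd)[y01 yx] yNx; apply: H.
Qed.

(** * Comparison of difference quotients and slopes *)

Lemma quotient_norm (R : realType) (v : R) (h : R -> R) (x y : R) :
  skew_self_similar v h -> x \in `[0, 1] -> y \in `[0, 1] ->
  (h y - h x) / (y - x) = `|h y - h x| / `|y - x|.
Proof.
move=> [hh _ _ _ _] xI yI; have [xy|/ltW yx] := leP x y.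
  by rewrite !ger0_norm ?subr_ge0 ?hh.
by rewrite !ler0_norm ?subr_le0 ?hh// invrN mulrNN.
Qed.

Lemma quotient_le_slope (R : realType) (v : R) (h : R -> R) (x y : R) d n :
  0 < v -> v < 1 -> skew_self_similar v h -> binary_expansion x d ->
  x \in `[0, 1] -> y \in `[0, 1] -> 2 ^- n.+1 <= `|y - x| <= 2 ^- n ->
  v * (1 - v) * ((h y - h x) / (y - x)) <= 4 * slope h d n.
Proof.
move=> v0 v1 hS hd xI yI /andP[yx1 yx2].
have e0 : 0 < 2 ^- n.+1 :> R by rewrite invr_gt0 exprn_gt0.
have yx0 := lt_le_trans e0 yx1.
have K := binary_prefix_lt d n.
have := oscillation_le v0 v1 hS K xI yI (binary_prefix_enclosure n hd) yx2.
rewrite (quotient_norm hS)// mulrA ler_pdivrMr// => /le_trans; apply.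
have -> : 2 * gap h n (binary_prefix d n) = 4 * slope h d n * 2 ^- n.+1.
  by rewrite /slope exprS; field; rewrite expf_neq0.
by apply: ler_wpM2l => //; rewrite mulr_ge0// (slope_ge0 _ _ hS).
Qed.

Lemma slope_le_quotient (R : realType) (v : R) (h : R -> R) (x y : R) d n :
  0 < v -> v < 1 -> skew_self_similar v h -> binary_expansion x d ->
  x \in `[0, 1] -> y \in `[0, 1] -> 2 ^- n.+1 <= `|y - x| <= 2 ^- n ->
  v * (1 - v) * slope h d n.+2 <= 4 * ((h y - h x) / (y - x)).
Proof.
move=> v0 v1 hS hd xI yI /andP[yx1 yx2].
have e0 : 0 < 2 ^- n.+1 :> R by rewrite invr_gt0 exprn_gt0.
have yx0 := lt_le_trans e0 yx1.
have yx3 : 2 * 2 ^- n.+2 <= `|y - x|.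
  apply: le_trans yx1; rewrite (exprS _ n.+1) invfM mulrA divff ?mul1r//.
have K := binary_prefix_lt d n.+2.
have := oscillation_ge v0 v1 hS K xI yI (binary_prefix_enclosure n.+2 hd) yx3.
rewrite (quotient_norm hS)// => osc; rewrite [leRHS]mulrA ler_pdivlMr//.
apply: le_trans (_ : v * (1 - v) * slope h d n.+2 * 2 ^- n <= _).
  apply: ler_wpM2l => //; apply: mulr_ge0 (slope_ge0 _ _ hS).
  by rewrite mulr_ge0 ?subr_ge0// ltW.
have -> : v * (1 - v) * slope h d n.+2 * 2 ^- n =
          4 * (v * (1 - v) * gap h n.+2 (binary_prefix d n.+2)).
  by rewrite /slope !exprS; field; rewrite expf_neq0.
by apply: ler_wpM2l.
Qed.

Lemma deriv01_cvg_slope (R : realType) (h : R -> R) (x : R) d l :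
  binary_expansion x d -> is_deriv01 h x l ->
  (slope h d n)%:E @[n --> \oo] --> l.
Proof.
move=> hd [_ /cvg_EFin_bounds[lo up]]; apply/cvg_EFin_bounds; split=> M Ml.
  have [N HN] := (near_punctured01 _ _).1 (lo _ Ml).
  exists N => // n /= Nn; apply: (slope_ge hd) => y yI yx ynx.
  by apply: HN => //; apply: le_trans ynx _; apply: exp2N_homo.
have [N HN] := (near_punctured01 _ _).1 (up _ Ml).
exists N => // n /= Nn; apply: (slope_le hd) => y yI yx ynx.
by apply: HN => //; apply: le_trans ynx _; apply: exp2N_homo.
Qed.

(** For these two limits one of the bounds is trivial and the other survives
    multiplication by a positive constant, so the comparison of quotients with
    slopes up to constants is enough. *)
Lemma cvg_slope_deriv01 (R : realType) (v : R) (h : R -> R) (x : R) d l :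
  0 < v -> v < 1 -> skew_self_similar v h -> binary_expansion x d ->
  x \in `[0, 1] -> l = 0%E \/ l = +oo%E ->
  (slope h d n)%:E @[n --> \oo] --> l -> is_deriv01 h x l.
Proof.
move=> v0 v1 hS hd xI l0y /cvg_EFin_bounds[lo up].
have c0 : 0 < v * (1 - v) by rewrite mulr_gt0// subr_gt0.
split; first by case: l0y => ->.
have scale y N : y \in `[0, 1] -> y != x -> `|y - x| <= 2 ^- N ->
    exists2 n, (N <= n)%N & 2 ^- n.+1 <= `|y - x| <= 2 ^- n.
  move=> yI yx yxN; apply: exists_exp2N_scale.
  by rewrite normr_gt0 subr_eq0 yx.
apply/cvg_EFin_bounds; split=> M Ml; apply/near_punctured01.
  case: l0y => lE; move: Ml; rewrite lE.
    rewrite lte_fin => /ltW M0; exists 0%N => y yI yx _; apply: le_trans M0 _.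
    by rewrite (quotient_norm hS)// divr_ge0.
  (* The constant of [slope_le_quotient], solved for the slope. *)
  move=> _; have [|N _ HN] := lo (4 * M / (v * (1 - v))).
    by rewrite lE ltry.
  exists N => y yI yx yxN; have [n Nn nyx] := scale y N yI yx yxN.
  have := slope_le_quotient v0 v1 hS hd xI yI nyx.
  have := HN n.+2 (leqW (leqW Nn)).
  rewrite /= ler_pdivrMr// [leRHS]mulrC => H /(le_trans H).
  by rewrite ler_pM2l.
case: l0y => lE; move: Ml; rewrite lE ?ltNge ?leey// -ltNge lte_fin => M0.
have [|N _ HN] := up (M * (v * (1 - v)) / 4).
  by rewrite lE lte_fin divr_gt0// mulr_gt0.
exists N => y yI yx yxN; have [n Nn nyx] := scale y N yI yx yxN.
have := quotient_le_slope v0 v1 hS hd xI yI nyx.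
have := HN n Nn; rewrite /= ler_pdivlMr// mulrC => H /le_trans /(_ H).
by rewrite mulrC ler_pM2r.
Qed.

(** * Possible values of the digit product *)

Lemma alpha_gt0 (R : realType) (v : R) (a b : bool) :
  0 < v -> v < 1 -> 0 < alpha v a b.
Proof. by move=> v0 v1; rewrite /alpha; case: ifP; rewrite ?subr_gt0. Qed.

(** Both [2 * v - 1] and [2 * (1 - v) - 1] have absolute value [`|2 * v - 1|],
    so consecutive partial products differ by exactly this multiple of the
    current one; a finite limit [r] then satisfies [`|2 * v - 1| * r = 0]. *)
Lemma digit_product_dichotomy (R : realType) (v : R) d p :
  0 < v -> v < 1 -> v != 1 / 2 -> is_digit_product v d p ->
  p = 0%E \/ p = +oo%E.
Proof.
move=> v0 v1 vN; rewrite /is_digit_product.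
set P := fun n => \prod_(2 <= k < n.+1) (2 * alpha v (d k) (d k.-1)).
have P0 n : 0 <= P n.
  by apply: prodr_ge0 => k _; rewrite mulr_ge0// ltW// alpha_gt0.
case: p => [r| |] Pp; [left|by right|].
  have {Pp} Pr : P n @[n --> \oo] --> r by have [] := (fine_cvgP _ _).1 Pp.
  have PS n : `|P (n + 2)%N - P (n + 1)%N| = `|2 * v - 1| * P (n + 1)%N.
    rewrite addn1 addn2; have -> : P n.+2 = 2 * alpha v (d n.+2) (d n.+1) * P n.+1.
      by rewrite /P big_nat_recr//= [LHS]mulrC.
    rewrite -[X in _ - X]mul1r -mulrBl normrM (ger0_norm (P0 _)).
    congr (_ * _); rewrite /alpha; case: ifP => // _.
    by rewrite -normrN; congr (`|_|); ring.
  have shift k : P (n + k)%N @[n --> \oo] --> r by rewrite cvg_shiftn.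
  have PS0 : `|2 * v - 1| * P (n + 1)%N @[n --> \oo] --> (0 : R).
    under eq_fun do rewrite -PS.
    rewrite -(normr0 R) -(subrr r); by apply: cvg_norm; apply: cvgB.
  have PSr : `|2 * v - 1| * P (n + 1)%N @[n --> \oo] --> `|2 * v - 1| * r.
    by apply: cvgM (shift 1%N); apply: cvg_cst.
  have : `|2 * v - 1| * r = 0 by apply: cvg_unique PSr PS0; apply: Rhausdorff.
  move=> /eqP; rewrite mulf_eq0 normr_eq0 subr_eq0 => /orP[/eqP v2|/eqP->//].
  by case/eqP: vN; lra.
have [_ /(_ (-1) (ltNyr _)) PN] := (cvg_EFin_bounds _ _).1 Pp.
have [n /= Pn] := filter_ex PN.
by have := le_trans (P0 n) Pn; rewrite oppr_ge0 ler10.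
Qed.

(** The distance from [h x] to [x] is half the distance at the image of [x]
    under the tent map, so it is at most [2 ^- n] for every [n]. *)
Lemma self_similar_half (R : realType) (h : R -> R) :
  skew_self_similar (1 / 2) h -> {in `[0, 1], forall x, h x = x}.
Proof.
move=> [hh h0 h1 hl hr].
have I0 : (0 : R) \in `[0, 1] by rewrite in_itv /= lexx ler01.
have I1 : (1 : R) \in `[0, 1] by rewrite in_itv /= lexx ler01.
have H n x : x \in `[0, 1] -> `|h x - x| <= 2 ^- n.
  elim: n x => [|n IHn] x xI; move: (xI); rewrite in_itv /= => /andP[x0 x1].
    have := hh _ _ I0 xI x0; have := hh _ _ xI I1 x1.
    by rewrite expr0 invr1 ler_norml h0 h1; lra.
  have [xh|xh] := leP x (1 / 2).
    have yI : 2 * x \in `[0, 1] by rewrite in_itv /=; lra.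
    have := hl _ yI; have -> : 2 * x / 2 = x by field.
    move=> ->; have -> : 1 / 2 * h (2 * x) - x = (h (2 * x) - 2 * x) / 2 by field.
    rewrite normrM exprSr invfM (ger0_norm (x := 2^-1)) ?invr_ge0//.
    by rewrite ler_pM2r// IHn.
  have yI : 2 - 2 * x \in `[0, 1] by rewrite in_itv /=; lra.
  have := hr _ yI; have -> : 1 - (2 - 2 * x) / 2 = x by field.
  move=> ->.
  have -> : 1 - (1 - 1 / 2) * h (2 - 2 * x) - x =
            - ((h (2 - 2 * x) - (2 - 2 * x)) / 2) by field.
  rewrite normrN normrM exprSr invfM (ger0_norm (x := 2^-1)) ?invr_ge0//.
  by rewrite ler_pM2r// IHn.
move=> x xI; apply/eqP; rewrite -subr_eq0 -normr_le0 leNgt.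
apply/negP => /exists_exp2N_lt[n]; rewrite ltNge => /negP; apply.
exact: H.
Qed.

(** * The derivative as a digit product *)

Lemma cvg_slope_digit_product (R : realType) (v : R) (h : R -> R) d p :
  skew_self_similar v h -> is_digit_product v d p ->
  (slope h d n)%:E @[n --> \oo] --> ((2 * alpha v (d 1%N) false)%:E * p)%E.
Proof.
move=> hS dp; rewrite -cvg_shiftS.
under eq_fun do rewrite (slope_prod _ _ hS) EFinM.
by apply: cvgeZl => //; move: dp; rewrite /is_digit_product -cvg_shiftS.
Qed.

Lemma digit_product_cvg_slope (R : realType) (v : R) (h : R -> R) d l :
  0 < v -> v < 1 -> skew_self_similar v h ->
  (slope h d n)%:E @[n --> \oo] --> l ->
  is_digit_product v d ((2 * alpha v (d 1%N) false)^-1%:E * l)%E.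
Proof.
move=> v0 v1 hS; rewrite -cvg_shiftS => sl.
rewrite /is_digit_product -cvg_shiftS.
have a0 : 2 * alpha v (d 1%N) false != 0.
  by rewrite gt_eqF// mulr_gt0// alpha_gt0.
have PE n : \prod_(2 <= k < n.+2) (2 * alpha v (d k) (d k.-1)) =
    (2 * alpha v (d 1%N) false)^-1 * slope h d n.+1.
  by rewrite (slope_prod _ _ hS) mulKf.
by under eq_fun do rewrite PE EFinM; apply: cvgeZl.
Qed.

Unset Implicit Arguments.

Theorem theorem4 (R : realType) (v : R) (hv0 : 0 < v) (hv1 : v < 1)
    (h : R -> R) (hh : conjugacy01 (@tent R) (skew_tent v) h)
    (x : R) (hx : x \in `[0, 1]) (d : nat -> bool)
    (hd : binary_expansion x d) :
  ((exists l : \bar R, is_deriv01 h x l) <->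
   (exists p : \bar R, is_digit_product v d p)) /\
  (forall l p : \bar R,
     is_deriv01 h x l -> is_digit_product v d p -> l = p).
Proof.
have hS := conjugacy_self_similar hv0 hv1 hh.
have [v2|vN2] := eqVneq v (1 / 2).
  have alpha2 a b : 2 * alpha v a b = 1.
    by rewrite /alpha v2; case: ifP => _; field.
  have p1 : is_digit_product v d 1%E.
    rewrite /is_digit_product; apply: cvg_near_cst; apply: nearW => n.
    by rewrite big1.
  have l1 : is_deriv01 h x 1%E.
    rewrite v2 in hS; split=> //; apply: cvg_near_cst.
    apply/near_punctured01; exists 0%N => y yI yx _.
    by rewrite !(self_similar_half hS)// divff// subr_eq0.
  split; first by split=> _; [exists 1%E|exists 1%E].
  move=> l p /(deriv01_cvg_slope hd) sl pd.
  have := cvg_slope_digit_product hS pd; rewrite alpha2 mul1e.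
  by apply: cvg_unique sl; exact: ereal_hausdorff.
have c0 : 0 < 2 * alpha v (d 1%N) false by rewrite mulr_gt0// alpha_gt0.
have cp p : p = 0%E \/ p = +oo%E -> ((2 * alpha v (d 1%N) false)%:E * p = p)%E.
  by case=> ->; rewrite ?mule0// gt0_muley// lte_fin.
split; first split.
- move=> [l /(deriv01_cvg_slope hd)].
  by move=> /(digit_product_cvg_slope hv0 hv1 hS) ?; eexists; eassumption.
- move=> [p pd]; exists p.
  have p0y := digit_product_dichotomy hv0 hv1 vN2 pd.
  apply: (cvg_slope_deriv01 hv0 hv1 hS hd hx p0y).
  by have := cvg_slope_digit_product hS pd; rewrite cp.
- move=> l p /(deriv01_cvg_slope hd) sl pd.
  have p0y := digit_product_dichotomy hv0 hv1 vN2 pd.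
  have := cvg_slope_digit_product hS pd; rewrite cp//.
  by apply: cvg_unique sl; exact: ereal_hausdorff.
Qed.
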